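(* Let $T_n$ be a tree with $n$ vertices and let $p$ be a positive real number. Then $$2^{\frac{1}{p}}\leq A_p(T_n)\leq (n-2)(n-1)^{\frac{1}{p}}.$$ The lower bound is attained if and only if $T_n\cong P_n$. The upper bound is attained if and only if $T_n\cong K_{1,\,n-1}$.
   Context: $d(v)$ is the degree of vertex $v$. For a positive real number $p$, the general Albertson irregularity index of a connected graph $G$ is $A_p(G)=\left(\sum_{uv\in E(G)}|d(u)-d(v)|^p\right)^{1/p}$. $P_n$ and $K_{1,\,n-1}$ denote the path and the star with $n$ vertices.
   Formalization: The lower bound and its equality case are stated only for n ≥ 3, since for n = 1, 2 the tree is a path with A_p = 0 < 2^{1/p}, so both claims fail there; the upper bound and its equality case are kept for all n ≥ 1. *)

(* Defs.v *)
From HB Require Import structures.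
From mathcomp Require Import all_boot all_order all_algebra.
From mathcomp Require Import reals exp.
Set Implicit Arguments.
Unset Strict Implicit.
Unset Printing Implicit Defensive.
Import Order.TTheory GRing.Theory Num.Theory.

Local Open Scope ring_scope.

Record sgraph := SGraph {
  vertex :> finType;
  adj : rel vertex;
  adj_sym : symmetric adj;
  adj_irr : irreflexive adj
}.

Definition deg (G : sgraph) (v : G) : nat := #|[pred w | adj v w]|.

Definition connected_graph (G : sgraph) : Prop :=
  (0 < #|G|)%N /\ forall x y : G, connect (@adj G) x y.

(* [ucycle] alone accepts c = [:: x; y] for every edge xy; requiring size at
   least 3 leaves exactly the cycles of a simple graph. *)
Definition acyclic_graph (G : sgraph) : Prop :=
  forall c : seq G, (3 <= size c)%N -> ~ ucycle (@adj G) c.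

Definition is_tree (G : sgraph) : Prop := connected_graph G /\ acyclic_graph G.

Definition graph_iso (G H : sgraph) : Prop :=
  exists2 f : G -> H, bijective f & forall x y : G, adj (f x) (f y) = adj x y.

Definition path_adj (n : nat) : rel 'I_n :=
  fun i j => (i.+1 == j :> nat) || (j.+1 == i :> nat).

Fact path_adj_sym n : symmetric (@path_adj n).
Proof. by move=> i j; rewrite /path_adj orbC. Qed.

Fact path_adj_irr n : irreflexive (@path_adj n).
Proof. by move=> i; rewrite /path_adj orbb; apply/negbTE; rewrite gtn_eqF. Qed.

Definition path_graph (n : nat) : sgraph :=
  SGraph (@path_adj_sym n) (@path_adj_irr n).

Definition bip_adj (m n : nat) : rel ('I_m + 'I_n)%type :=
  fun x y => match x, y with
             | inl _, inr _ | inr _, inl _ => true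
             | _, _ => false
             end.

Fact bip_adj_sym m n : symmetric (@bip_adj m n).
Proof. by case=> [i|i] [j|j]. Qed.

Fact bip_adj_irr m n : irreflexive (@bip_adj m n).
Proof. by case. Qed.

Definition complete_bipartite (m n : nat) : sgraph :=
  SGraph (@bip_adj_sym m n) (@bip_adj_irr m n).

(* The sum is over unordered edges: the condition on [enum_rank] selects one of
   the two orientations of each edge. *)
Definition albertson (R : realType) (p : R) (G : sgraph) : R :=
  (\sum_(u : G) \sum_(v : G | adj u v && (enum_rank u < enum_rank v)%N)
     `| (deg u)%:R - (deg v)%:R | `^ p) `^ p^-1.

(* Main.v *)
(* Root the tree at r. Every edge is a bridge, so it must join some vertex to
   its breadth-first parent; hence the degrees sum to 2(n - 1), and counting
   deg v + [deg v = 1] >= 2 gives at least two leaves, with exactly two iff all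
   degrees are at most 2, i.e. iff the tree is a path. An edge uv contributes at
   least [deg u = 1] + [deg v = 1] to the irregularity sum when n >= 3, as two
   leaves are then never adjacent, with equality when both degrees are at most 2.
   Above, each of the n - 1 edges contributes at most (n - 2)^p, and an edge
   attaining this has an endpoint of degree n - 1, the centre of a star. *)
Require Import Defs.
From mathcomp Require Import all_boot all_order all_algebra.
From mathcomp Require Import reals exp.
From mathcomp Require Import zify ring lra.
Import Order.TTheory GRing.Theory Num.Theory.
Local Open Scope ring_scope.

(** * Breadth-first parents and the degree sum *)

(** [h] is the distance from [r], and [par] picks a neighbour one step closer to [r]. *)
Lemma bfs_parent (G : sgraph) (r : G) : connected_graph G ->
  exists (h : G -> nat) (par : G -> G),
    [/\ forall v, (h v < #|G|)%N,
        h r = 0%N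
      & forall v, v != r -> adj v (par v) /\ h v = (h (par v)).+1].
Proof.
move=> [_ conG].
pose P v k := [exists s : k.-tuple G, path (@adj G) r s && (last r s == v)].
have PI v s : path (@adj G) r s -> last r s = v -> P v (size s).
  move=> ps ls; apply/existsP; exists (in_tuple s).
  by rewrite /= ps ls eqxx.
have exP v : exists k, P v k.
  by have /connectP [s ps ls] := conG r v; exists (size s); apply: PI.
pose h v := ex_minn (exP v).
have hmin v s : path (@adj G) r s -> last r s = v -> (h v <= size s)%N.
  by move=> ps ls; rewrite /h; case: ex_minnP => k _; apply; apply: PI.
have hpath v : exists s, [/\ path (@adj G) r s, last r s = v & size s = h v].
  rewrite /h; case: ex_minnP => k /existsP [s /andP [ps /eqP ls]] _.
  by exists s; rewrite size_tuple.
have hS v w : adj v w -> (h w <= (h v).+1)%N.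
  move=> vw; have [s [ps ls <-]] := hpath v.
  by rewrite -(size_rcons s w); apply: hmin; rewrite ?rcons_path ?last_rcons ?ps ?ls.
have hr : h r = 0%N by apply/eqP; rewrite -leqn0; apply: (hmin r [::]).
have step v : v != r -> exists w, adj v w && (h v == (h w).+1).
  move=> vr; have [s] := hpath v.
  case/lastP: s => [[_ rv _]|s w []]; first by rewrite -rv eqxx in vr.
  rewrite rcons_path last_rcons size_rcons => /andP [ps lw] wv hv; subst w.
  (* A shortest walk without its last vertex is again shortest. *)
  exists (last r s); rewrite adj_sym lw -hv /= eqSS eqn_leq.
  rewrite (hmin _ s) // andbT.
  by rewrite -ltnS hv hS // lw.
(* The default [r] is reached only at [v = r], where [par] is unconstrained. *)
exists h, (fun v => odflt r [pick w | adj v w && (h v == (h w).+1)]); split => //.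
- move=> v; have /connectP [s ps ls] := conG r v.
  case/shortenP: ps ls => s' ps' us' _ ls'.
  apply: (leq_ltn_trans (hmin _ _ ps' (esym ls'))).
  by have := max_card (mem (r :: s')); rewrite (card_uniqP us').
- move=> v /step [w0 w0P]; case: pickP => [w /= /andP [? /eqP ?] //|/(_ w0)].
  by rewrite w0P.
Qed.

(** A simple path from [u] to [v] avoiding this edge would close up with it to a cycle, of size at
    least 3 since there are no loops and the direct step is excluded. *)
Lemma acyclic_edge_bridge (G : sgraph) (u v : G) : acyclic_graph G -> adj u v ->
  ~~ connect [rel x y | adj x y && ([set x; y] != [set u; v])] u v.
Proof.
move=> acG uv; apply/negP => /connectP [s ps ls].
case/shortenP: ps ls => {}s ps us _ ls.
have pG : path (@adj G) u s by apply: sub_path ps => x y /andP [].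
apply: (acG (u :: s)); last first.
  by rewrite /ucycle us andbT /= rcons_path pG -ls adj_sym.
case: s ps us ls {pG} => [|a [|b s]] //=.
  by move=> _ _ vu; rewrite vu adj_irr in uv.
by move=> /andP [/andP [_ +] _] _ va; rewrite va eqxx.
Qed.

Section RootedTree.
Variables (G : sgraph) (r : G) (h : G -> nat) (par : G -> G).
Hypothesis acG : acyclic_graph G.
Hypothesis parP : forall v, v != r -> adj v (par v) /\ h v = (h (par v)).+1.

(* If neither endpoint is the parent of the other, the parent chains from u and v
   to the root avoid the edge uv, contradicting that it is a bridge. *)
Lemma adj_parent (u v : G) :
  adj u v = (u != r) && (par u == v) || (v != r) && (par v == u).
Proof.
apply/idP/orP => [uv|[]/andP [/parP [+ _] /eqP <-] //]; last by rewrite adj_sym.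
have [//|nu] := boolP ((u != r) && (par u == v)); first by left.
have [//|nv] := boolP ((v != r) && (par v == u)); first by right.
have /negP[] := acyclic_edge_bridge G u v acG uv.
set e := [rel _ _ | _].
have esym : connect_sym e.
  by apply: sym_connect_sym => x y; rewrite /= adj_sym setUC.
suff conr w : connect e w r.
  by apply: connect_trans (conr u) _; rewrite esym.
elim: {w}(h w) {-2}w (leqnn (h w)) => [|k IH] w.
  have [->|/parP [_ ->]] := eqVneq w r; first by rewrite connect0.
  by [].
have [->|wr] := eqVneq w r; first by rewrite connect0.
have [aw hw] := parP w wr.
rewrite hw ltnS => /IH; apply: connect_trans; apply: connect1.
rewrite /= aw /=; apply/eqP => E.
have /set2P wE : w \in [set u; v] by rewrite -E set21.
have /set2P pE : par w \in [set u; v] by rewrite -E set22.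
have pw : par w != w by apply: contraTneq aw => ->; rewrite adj_irr.
case: wE pE pw wr nu nv => -> [] ->; by rewrite ?eqxx ?andbT => // _ ->.
Qed.

(** Every non-root vertex yields one parent edge, counted from both ends. *)
Lemma sum_deg : (\sum_(u : G) deg u = 2 * #|G|.-1)%N.
Proof.
have cardr : (\sum_(u : G | u != r) 1 = #|G|.-1)%N.
  by rewrite sum1_card cardC1.
have half : (\sum_(u : G) \sum_(v : G) ((u != r) && (par u == v)) = #|G|.-1)%N.
  rewrite -cardr [RHS]big_mkcond /=; apply: eq_bigr => u _.
  case: (u != r) => /=; last by rewrite big1.
  by rewrite -big_mkcond (big_pred1 (par u)) // => v; rewrite eq_sym.
rewrite mul2n -addnn -{1}half -half [X in (_ + X)%N]exchange_big -big_split /=.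
apply: eq_bigr => u _; rewrite -big_split /deg -sum1_card big_mkcond /=.
apply: eq_bigr => v _; rewrite inE adj_parent.
have [/andP[ur /eqP <-]|//] := boolP ((u != r) && (par u == v)).
(* Mutual parents would each be higher than the other, so no adjacency is counted twice. *)
have [_ hu] := parP u ur.
have [/andP[/parP [_ hv] /eqP E]|//] := boolP (_ && _).
by rewrite E in hv; lia.
Qed.

End RootedTree.

Lemma tree_sum_deg (G : sgraph) : is_tree G -> (\sum_(u : G) deg u = 2 * #|G|.-1)%N.
Proof.
move=> [cG aG]; have [/card_gt0P [r _] _] := cG.
by have [h [par [_ _ hP]]] := bfs_parent G r cG; apply: sum_deg hP.
Qed.

(** * Degrees and leaves *)

(** Rooting at another vertex gives [u] a parent. *)
Lemma deg_gt0 (G : sgraph) (u : G) : connected_graph G -> (1 < #|G|)%N -> (0 < deg u)%N.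
Proof.
move=> cG n1.
have /card_gt0P [r] : (0 < #|predC1 u|)%N by rewrite cardC1; lia.
rewrite inE eq_sym => ur.
have [h [par [_ _ hP]]] := bfs_parent G r cG.
by apply/card_gt0P; exists (par u); rewrite inE; case: (hP u ur).
Qed.

Lemma deg_le_pred (G : sgraph) (u : G) : (deg u <= #|G|.-1)%N.
Proof.
rewrite -(cardC1 u); apply/subset_leq_card/subsetP => w; rewrite !inE.
by apply: contraTneq => ->; rewrite adj_irr.
Qed.

Lemma deg_le1_inj (G : sgraph) (u x y : G) :
  (deg u <= 1)%N -> adj u x -> adj u y -> x = y.
Proof. by move=> /card_le1_eqP d1 ux uy; apply: d1. Qed.

(** With a third vertex as root, two adjacent leaves would be each other's parent. *)
Lemma leaves_not_adj (G : sgraph) (u v : G) : connected_graph G -> (2 < #|G|)%N ->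
  adj u v -> deg u = 1%N -> deg v = 1%N -> False.
Proof.
move=> cG n2 uv du dv.
have /card_gt0P [r] : (0 < #|~: [set u; v]|)%N.
  by have := cardsC [set u; v]; rewrite cards2; case: (u != v); lia.
rewrite !inE negb_or eq_sym (eq_sym r) => /andP [ur vr].
have [h [par [_ _ hP]]] := bfs_parent G r cG.
have [au hu] := hP u ur; have [av hv] := hP v vr.
have pu : par u = v by apply: (@deg_le1_inj _ u); rewrite ?du.
have pv : par v = u by apply: (@deg_le1_inj _ v); rewrite ?dv // adj_sym.
by rewrite pu in hu; rewrite pv in hv; lia.
Qed.

Definition num_leaves (G : sgraph) : nat := (\sum_(u : G) (deg u == 1))%N.

Lemma num_leaves_leqif (G : sgraph) : is_tree G -> (2 < #|G|)%N ->
  (2 <= num_leaves G ?= iff [forall u : G, deg u <= 2])%N.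
Proof.
move=> tG n2; have [cG _] := tG.
have dlt (u : G) : true -> (2 <= deg u + (deg u == 1) ?= iff (deg u <= 2))%N.
  move=> _; have := deg_gt0 G u cG (ltnW n2).
  by case: (deg u) => [|[|[|k]]] // _; apply/leqifP; rewrite /= addn0.
have := leqif_sum dlt; rewrite sum_nat_const big_split /= tree_sum_deg //.
rewrite (_ : #|_| = #|G|); last exact: eq_card.
rewrite -/(num_leaves G) /leqif => -[le1 <-]; split; first by lia.
by apply/eqP/eqP; lia.
Qed.

(** * Recognising paths and stars *)

Lemma deg_iso (G H : sgraph) (f : G -> H) : bijective f ->
  (forall x y, adj (f x) (f y) = adj x y) -> forall x, deg (f x) = deg x.
Proof.
move=> bf fa x; rewrite /deg -[RHS](card_image (bij_inj bf)).
apply: eq_card => w; have [g fK gK] := bf.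
by rewrite -(gK w) inE fa mem_image //; apply: bij_inj.
Qed.

Lemma deg_path_graph (n : nat) (i : path_graph n) : (deg i <= 2)%N.
Proof.
rewrite /deg cardE -(size_map val).
(* At [i = 0] the second candidate is [0] itself, harmless for an upper bound. *)
apply: (@uniq_leq_size _ _ [:: (val i).+1; (val i).-1]).
  by rewrite map_inj_uniq ?enum_uniq //; apply: val_inj.
move=> k /mapP [j]; rewrite mem_enum inE /= /path_adj => ij ->.
by rewrite !inE; move: ij => /orP [] /eqP <- /=; rewrite eqxx ?orbT.
Qed.

(* The isomorphism is the distance from a leaf: it is injective because no vertex
   has two children. *)
Lemma path_iso (G : sgraph) : is_tree G -> (2 < #|G|)%N ->
  (forall u : G, deg u <= 2)%N -> graph_iso G (path_graph #|G|).
Proof.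
move=> tG n2 d2; have [cG aG] := tG.
have [r r1] : exists r : G, deg r = 1%N.
  have [+ _] := num_leaves_leqif G tG n2.
  have [/existsP [r /eqP]|/existsPn nl] := boolP [exists r : G, deg r == 1%N].
    by exists r.
  by rewrite /num_leaves big1 // => u _; rewrite (negbTE (nl u)).
have [h [par [hn hr hP]]] := bfs_parent G r cG.
have adjE := adj_parent G r h par aG hP.
(* The root is a leaf, and any other vertex with two children would have degree 3, counting its
   parent. *)
have par_inj x y : x != r -> y != r -> par x = par y -> x = y.
  move=> xr yr E; have [ax hx] := hP x xr; have [ay hy] := hP y yr.
  have [pr|pr] := eqVneq (par x) r.
    have rx : adj r x by rewrite -pr adj_sym.
    have ry : adj r y by rewrite -pr E adj_sym.
    by apply: deg_le1_inj rx ry; rewrite r1.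
  have [ap hp] := hP _ pr.
  apply/eqP; apply: contraT => xy; have := d2 (par x).
  rewrite leqNgt => /negP []; apply/card_gt2P; exists x, y, (par (par x)).
  have ay' : adj (par x) y by rewrite E adj_sym.
  rewrite !inE ap adj_sym ax ay' xy; split=> //; split=> //.
    by apply/eqP => yE; move: hp; rewrite -yE hy -E; lia.
  by apply/eqP => xE; move: hp; rewrite xE hx; lia.
(* By induction, vertices of equal height have equal parents. *)
have h_inj : injective h.
  move=> x y; move Ek: (h x) => k; elim: k x y Ek => [|k IH] x y hx hy.
    have [->|/hP [_]] := eqVneq x r; last by rewrite hx.
    by have [->|/hP [_]] := eqVneq y r; last rewrite -hy.
  have xr : x != r by apply: contra_eq_neq hx => ->; rewrite hr.
  have yr : y != r by apply: contra_eq_neq (esym hy) => ->; rewrite hr.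
  have [_ hx'] := hP x xr; have [_ hy'] := hP y yr.
  by apply: par_inj => //; apply: IH; lia.
exists (fun x => Ordinal (hn x)).
  by apply: inj_card_bij; rewrite ?card_ord // => x y /(congr1 val) /h_inj.
move=> x y; rewrite adjE /= /path_adj /= orbC.
have nextE u v : ((h v).+1 == h u) = (u != r) && (par u == v).
  have [->|ur] /= := eqVneq u r; first by rewrite hr.
  by have [_ ->] := hP u ur; rewrite eqSS (inj_eq h_inj) eq_sym.
by rewrite !nextE.
Qed.

(** [c] is adjacent to all other vertices, so an edge missing [c] would form a triangle with it. *)
Lemma hub_adj (G : sgraph) (c : G) : acyclic_graph G -> deg c = #|G|.-1 ->
  forall x y : G, adj x y = (x != y) && ((x == c) || (y == c)).
Proof.
move=> aG dc.
have ac x : x != c -> adj c x.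
  have sub : [pred w | adj c w] \subset predC1 c.
    by apply/subsetP => w; rewrite !inE; apply: contraTneq => ->; rewrite adj_irr.
  have /subset_cardP : #|[pred w | adj c w]| = #|predC1 c| by rewrite cardC1.
  by move=> /(_ sub) /(_ x); rewrite !inE => ->.
move=> x y; have [->|xy] := eqVneq x y; first by rewrite adj_irr.
have [xc|xc] := eqVneq x c; first by rewrite xc in xy *; apply: ac; rewrite eq_sym.
have [yc|yc] := eqVneq y c; first by rewrite yc in xy *; rewrite adj_sym ac.
apply/negP => axy; apply: (aG [:: c; x; y]) => //.
by rewrite /ucycle /= ac // axy adj_sym ac //= !inE xy negb_or eq_sym xc eq_sym yc.
Qed.

Lemma star_iso (G : sgraph) (c : G) : acyclic_graph G -> deg c = #|G|.-1 ->
  graph_iso G (complete_bipartite 1 #|G|.-1).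
Proof.
move=> aG dc.
(* [unlift] renumbers the vertices other than [c], skipping the rank of [c]. *)
pose f v : complete_bipartite 1 #|G|.-1 :=
  if unlift (enum_rank c) (enum_rank v) is Some j then inr j else inl ord0.
have fc : f c = inl ord0 by rewrite /f unlift_none.
have fnc v : v != c -> exists2 j, f v = inr j & enum_rank v = lift (enum_rank c) j.
  move=> vc; have /unlift_some [j vj uj] : enum_rank c != enum_rank v.
    by rewrite (inj_eq enum_rank_inj) eq_sym.
  by exists j; rewrite // /f uj.
have n0 : (0 < #|G|)%N by apply/card_gt0P; exists c.
exists f.
  apply: inj_card_bij; last by rewrite card_sum !card_ord; lia.
  move=> x y; have [->|/fnc [i -> xi]] := eqVneq x c;
    have [->|/fnc [j -> yj]] := eqVneq y c; rewrite ?fc //.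
  by move=> [ij]; apply: enum_rank_inj; rewrite xi yj ij.
move=> x y; rewrite (hub_adj G c) //.
have [->|xc] := eqVneq x c; have [->|yc] := eqVneq y c; rewrite ?fc ?eqxx //=.
- by have [j -> _] := fnc y yc.
- by have [j -> _] := fnc x xc; rewrite xc.
- by have [i -> _] := fnc x xc; have [j -> _] := fnc y yc; rewrite andbF.
Qed.

Lemma iso_star_hub (G : sgraph) (m : nat) :
  graph_iso G (complete_bipartite 1 m) -> exists c : G, deg c = m.
Proof.
move=> [f bf fa]; have [g fK gK] := bf.
exists (g (inl ord0)); rewrite -(deg_iso _ _ f) // gK /deg.
rewrite -[RHS]card_ord -(card_codom (f := @inr 'I_1 'I_m)); last by move=> ? ? [].
apply: eq_card => -[i|j]; rewrite !inE /=; last by rewrite codom_f.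
by apply/esym/negP => /codomP [].
Qed.

(** * Irregularity sums over ordered edges *)

Section EdgeSums.
Variables (R : realType) (G : sgraph).

Lemma sum_edges_src (f : G -> R) :
  \sum_(e : G * G | adj e.1 e.2) f e.1 = \sum_(u : G) f u *+ deg u.
Proof.
rewrite -(pair_big_dep xpredT (fun u v => adj u v) (fun u _ => f u)) /=.
by apply: eq_bigr => u _; rewrite sumr_const.
Qed.

Lemma sum_edges_tgt (f : G -> R) :
  \sum_(e : G * G | adj e.1 e.2) f e.2 = \sum_(u : G) f u *+ deg u.
Proof.
rewrite -sum_edges_src.
rewrite (reindex_inj (h := fun e : G * G => (e.2, e.1))) /=; last first.
  by move=> [a b] [a' b'] [-> ->].
by apply: eq_bigl => e; rewrite adj_sym.
Qed.

Definition imbalance (p : R) (u v : G) : R := `| (deg u)%:R - (deg v)%:R | `^ p.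

Definition imbalance_sum (p : R) : R :=
  \sum_(e : G * G | adj e.1 e.2) imbalance p e.1 e.2.

(* [imbalance_sum] runs over ordered edges, hence counts every edge twice. *)
Lemma albertsonE (p : R) : albertson p G = (imbalance_sum p / 2) `^ p^-1.
Proof.
rewrite /albertson; congr (_ `^ _); apply: (canRL (mulfK _)); first by rewrite pnatr_eq0.
rewrite mulr_natr mulr2n /imbalance_sum.
rewrite -(pair_big_dep xpredT (fun u v => adj u v) (imbalance p)) /=.
under [RHS]eq_bigr => u _ do
  rewrite (bigID (fun v => (enum_rank u < enum_rank v)%N)) /=.
rewrite big_split /=; congr (_ + _).
(* Reversing edges matches the two orientations; ranks of adjacent vertices are never equal. *)
rewrite (exchange_big_dep xpredT) //=; apply: eq_bigr => u _.
apply: eq_big => [v|v _]; last by rewrite /imbalance distrC.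
rewrite adj_sym -leqNgt; have [uv|//] := boolP (adj u v).
rewrite ltn_neqAle (inj_eq val_inj) (inj_eq enum_rank_inj).
by have [vu|//] := eqVneq v u; rewrite vu adj_irr in uv.
Qed.

Lemma imbalance_sum_ge0 (p : R) : 0 <= imbalance_sum p.
Proof. by apply: sumr_ge0 => e _; apply: powR_ge0. Qed.

(** Brings degree differences back to [nat], within reach of [lia]. *)
Lemma natr_dist (a b : nat) :
  `|a%:R - b%:R| = (maxn a b - minn a b)%:R :> R.
Proof.
have [ab|ba] := leqP a b.
  by rewrite distrC -natrB // normr_nat.
by rewrite -natrB ?normr_nat // ltnW.
Qed.

Lemma ge1_powRn (p : R) (k : nat) : 0 < p -> (0 < k)%N -> 1 <= k%:R `^ p.
Proof. by move=> p0 k0; rewrite -[leLHS](powRr0 k%:R) ler_powR; rewrite ?ler1n // ltW. Qed.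

(** At most one endpoint is a leaf, and then the degrees differ by at least 1. *)
Lemma edge_imbalance_ge (p : R) (u v : G) :
  0 < p -> connected_graph G -> (2 < #|G|)%N -> adj u v ->
  (deg u == 1)%:R + (deg v == 1)%:R <= imbalance p u v.
Proof.
move=> p0 cG n2 uv; rewrite -natrD /imbalance natr_dist.
have nl := leaves_not_adj G u v cG n2 uv.
have du := deg_gt0 G u cG (ltnW n2); have dv := deg_gt0 G v cG (ltnW n2).
have [u1|u1] := eqVneq (deg u) 1%N; have [v1|v1] := eqVneq (deg v) 1%N.
- by case: nl.
- by apply: ge1_powRn => //; lia.
- by apply: ge1_powRn => //; lia.
- exact: powR_ge0.
Qed.

Lemma edge_imbalance_deg2 (p : R) (u v : G) :
  0 < p -> connected_graph G -> (2 < #|G|)%N -> adj u v ->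
  (deg u <= 2)%N -> (deg v <= 2)%N ->
  imbalance p u v = (deg u == 1)%:R + (deg v == 1)%:R.
Proof.
move=> p0 cG n2 uv; rewrite -natrD /imbalance natr_dist.
have nl := leaves_not_adj G u v cG n2 uv.
have du := deg_gt0 G u cG (ltnW n2); have dv := deg_gt0 G v cG (ltnW n2).
move: nl du dv; case: (deg u) => [|[|[|?]]] //; case: (deg v) => [|[|[|?]]] //.
- by move=> nl; case: nl.
- by rewrite powR1.
- by rewrite powR1.
- by rewrite powR0 // gt_eqF.
Qed.

(** A leaf is the source of one ordered edge and the target of one. *)
Lemma sum_edges_leaf :
  \sum_(e : G * G | adj e.1 e.2) ((deg e.1 == 1)%:R + (deg e.2 == 1)%:R)
    = (2 * num_leaves G)%:R :> R.
Proof.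
rewrite big_split /= (sum_edges_src (fun u => (deg u == 1)%:R)).
rewrite (sum_edges_tgt (fun u => (deg u == 1)%:R)).
rewrite mul2n -addnn natrD /num_leaves natr_sum.
by congr (_ + _); apply: eq_bigr => u _; case: eqP => [->|] //; rewrite mul0rn.
Qed.

Lemma imbalance_sum_lower (p : R) : 0 < p -> is_tree G -> (2 < #|G|)%N ->
  4 <= imbalance_sum p /\ (imbalance_sum p = 4 <-> forall u : G, (deg u <= 2)%N).
Proof.
move=> p0 tG n2; have [cG _] := tG.
have [l2 l2E] := num_leaves_leqif G tG n2.
have le1 : (2 * num_leaves G)%:R <= imbalance_sum p.
  by rewrite -sum_edges_leaf; apply: ler_sum => e; apply: edge_imbalance_ge.
split; first by apply: le_trans le1; rewrite ler_nat; lia.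
split=> [D4|d2].
  (* [le1] now caps the number of leaves at two. *)
  apply/forallP; rewrite -l2E eqn_leq l2.
  by move: le1; rewrite D4 ler_nat; lia.
have -> : imbalance_sum p = (2 * num_leaves G)%:R.
  rewrite -sum_edges_leaf; apply: eq_bigr => e ae.
  exact: edge_imbalance_deg2.
by have /eqP <- : (2 == num_leaves G)%N by rewrite l2E; apply/forallP.
Qed.

Lemma edge_imbalance_le (p : R) (u v : G) : 0 < p -> connected_graph G -> adj u v ->
  imbalance p u v <= (#|G| - 2)%:R `^ p.
Proof.
move=> p0 cG uv.
have n1 : (1 < #|G|)%N.
  by apply/card_gt1P; exists u, v; split=> //; apply: contraTneq uv => ->; rewrite adj_irr.
have du := deg_gt0 G u cG n1; have dv := deg_gt0 G v cG n1.
have lu := deg_le_pred G u; have lv := deg_le_pred G v.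
rewrite /imbalance natr_dist; apply: ge0_ler_powR; rewrite ?nnegrE ?ler0n //.
  exact: ltW.
by rewrite ler_nat; lia.
Qed.

Lemma sum_edges_const (x : R) : is_tree G ->
  \sum_(e : G * G | adj e.1 e.2) x = (2 * #|G|.-1)%:R * x.
Proof.
move=> tG; rewrite (sum_edges_src (fun=> x)) sumrMnr.
by rewrite tree_sum_deg // mulr_natl.
Qed.

Lemma imbalance_sum_upper (p : R) : 0 < p -> is_tree G -> (1 < #|G|)%N ->
  let bound := (2 * #|G|.-1)%:R * (#|G| - 2)%:R `^ p in
  imbalance_sum p <= bound
  /\ (imbalance_sum p = bound <-> exists c : G, deg c = #|G|.-1).
Proof.
move=> p0 tG n1 bound; have [cG aG] := tG.
rewrite {}/bound -sum_edges_const //.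
have le1 (e : G * G) : adj e.1 e.2 -> imbalance p e.1 e.2 <= (#|G| - 2)%:R `^ p.
  exact: edge_imbalance_le.
split; first exact: ler_sum.
split=> [E|[c dc]].
  have [u _] : exists u : G, u \in predT by apply/card_gt0P; apply: ltnW.
  have /card_gt0P [v] := deg_gt0 G u cG n1; rewrite inE => uv.
  (* Nonnegative gaps with sum zero all vanish, so the edge [uv] attains the maximum. *)
  have /psumr_eq0P F0 : \sum_(e : G * G | adj e.1 e.2)
      ((#|G| - 2)%:R `^ p - imbalance p e.1 e.2) = 0.
    by rewrite sumrB -E subrr.
  have /(_ (u, v) uv) /= : forall e : G * G, adj e.1 e.2 ->
      (#|G| - 2)%:R `^ p - imbalance p e.1 e.2 = 0.
    by apply: F0 => e ae; rewrite subr_ge0 le1.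
  move=> /subr0_eq /(powR_injective p0); rewrite !nnegrE ler0n normr_ge0.
  move=> /(_ isT isT) /eqP; rewrite natr_dist eqr_nat => /eqP E2.
  have {}E2 : (#|G| - 2 = maxn (deg u) (deg v) - minn (deg u) (deg v) :> nat)%N by [].
  have du := deg_gt0 G u cG n1; have dv := deg_gt0 G v cG n1.
  have lu := deg_le_pred G u; have lv := deg_le_pred G v.
  (* Degrees lie between 1 and [#|G|.-1], so a gap of [#|G| - 2] uses both extremes. *)
  have : maxn (deg u) (deg v) = #|G|.-1 by clear -n1 du lu dv lv E2; lia.
  by have [_|_] := leqP (deg u) (deg v); [exists v|exists u].
have hub := hub_adj G c aG dc.
have d1 x : x != c -> deg x = 1%N.
  move=> xc; rewrite /deg -(card1 c); apply: eq_card => w.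
  rewrite !inE hub (negbTE xc) /=.
  by have [->|] := eqVneq w c; rewrite ?xc ?andbF.
have dist_hub : (maxn #|G|.-1 1 - minn #|G|.-1 1 = #|G| - 2 :> nat)%N.
  by clear -n1; lia.
apply: eq_bigr => -[u v] /=; rewrite hub => /andP [uv /orP [] /eqP E].
  by rewrite /imbalance E (d1 v) ?dc -?E 1?eq_sym // natr_dist dist_hub.
by rewrite /imbalance E (d1 u) ?dc -?E // natr_dist maxnC minnC dist_hub.
Qed.

End EdgeSums.

(** * Bounds for the index and their equality cases *)

(** The lower bound starts at [n = 3]: on one or two vertices all degrees agree and the index is
    0. *)
Theorem theorem4p1 (R : realType) (p : R) (n : nat) (G : sgraph) :
  0 < p -> is_tree G -> #|G| = n ->
  ((3 <= n)%N ->
     2 `^ p^-1 <= albertson p G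
     /\ (albertson p G = 2 `^ p^-1 <-> graph_iso G (path_graph n)))
  /\ (albertson p G <= (n%:R - 2) * (n%:R - 1) `^ p^-1
      /\ (albertson p G = (n%:R - 2) * (n%:R - 1) `^ p^-1
          <-> graph_iso G (complete_bipartite 1 n.-1))).
Proof.
move=> p0 tG <-; have [cG aG] := tG.
have q0 : 0 < p^-1 by rewrite invr_gt0.
have D0 : 0 <= imbalance_sum R G p / 2 by rewrite divr_ge0 ?imbalance_sum_ge0.
have leq_root (a b : R) : 0 <= a -> 0 <= b -> a <= b -> a `^ p^-1 <= b `^ p^-1.
  by move=> a0 b0; apply: ge0_ler_powR; rewrite ?nnegrE // ltW.
have eq_root (a b : R) : 0 <= a -> 0 <= b -> a `^ p^-1 = b `^ p^-1 <-> a = b.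
  by move=> a0 b0; split=> [|-> //]; apply: powR_injective; rewrite ?nnegrE.
rewrite albertsonE; split=> [n2|].
  have [D4 D4E] := imbalance_sum_lower R G p p0 tG n2.
  split; first by apply: leq_root => //; rewrite ler_pdivlMr // -natrM.
  rewrite eq_root //; split=> [D|[f bf fa]].
    apply: path_iso => //; apply/D4E.
    by lra.
  have -> : imbalance_sum R G p = 4.
    by apply/D4E => u; rewrite -(deg_iso _ _ f bf fa) deg_path_graph.
  by lra.
have [n1|n1] := leqP #|G| 1%N.
  have n1E : #|G| = 1%N by case: cG => n0 _; lia.
  have [c _] : exists c : G, c \in predT by apply/card_gt0P; rewrite n1E.
  have D : imbalance_sum R G p = 0.
    rewrite /imbalance_sum big_pred0 // => -[u v] /=.
    by rewrite (fintype_le1P _ u v) ?n1E // adj_irr.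
  have -> : (#|G|%:R - 1) `^ p^-1 = 0 :> R by rewrite n1E subrr powR0 ?gt_eqF.
  rewrite D mul0r mulr0 powR0 ?gt_eqF //; split=> //; split=> // _.
  apply: (star_iso G c aG).
  by apply/eqP; rewrite eqn_leq deg_le_pred n1E.
have [U UE] := imbalance_sum_upper R G p p0 tG n1.
(* The bound with the factor [n - 2] moved under the root; truncated subtraction is exact since
   [n >= 2]. *)
pose B : R := (#|G| - 2)%:R `^ p * (#|G|.-1)%:R.
have BE : (#|G|%:R - 2) * (#|G|%:R - 1) `^ p^-1 = B `^ p^-1.
  rewrite /B powRM ?powR_ge0 ?ler0n // -powRrM divff ?gt_eqF // powRr1 ?ler0n //.
  by rewrite -subn1 !natrB // ltnW.
have B0 : 0 <= B by rewrite mulr_ge0 ?powR_ge0.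
have B2 : (2 * #|G|.-1)%:R * (#|G| - 2)%:R `^ p = B * 2 by rewrite /B natrM; ring.
rewrite B2 in U UE; rewrite BE.
split; first by apply: leq_root => //; rewrite ler_pdivrMr.
rewrite eq_root //; split=> [D|/iso_star_hub /UE ->]; last by rewrite mulfK ?pnatr_eq0.
have /UE [c] : imbalance_sum R G p = B * 2 by rewrite -D divfK ?pnatr_eq0.
exact: star_iso.
Qed.
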